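(* Let $M\subset\mathbb{R}^{2d}$ satisfy the standing assumptions below, let $T$ be its outer symplectic billiard map and $H$ the function defined below, and write $|x|_H:=H(x)$. There exist constants $\Lambda>0$ and $\bar C>0$, depending only on $M$, such that for every $x$ with $|x|_H\ge\Lambda$ and every integer $k\ge1$, $$\big|\,|T^{2k}(x)|_H^2-|x|_H^2\,\big|\le \bar C\,k.$$
   Context: Equip $\mathbb{R}^{2d}$ with the standard inner product, norm $|\cdot|$, complex structure $J$ ($J^2=-I$, orthogonal) and symplectic form $\omega(u,v)=\langle Ju,v\rangle$. Standing assumptions: $M\subset\mathbb{R}^{2d}$ is a smooth closed hypersurface bounding a strictly convex domain containing the origin in its interior, and $M$ is a level set of a smooth function with positive definite Hessian. For a hypersurface $Q$ of this kind and $q\in Q$, the Reeb vector $R_Q(q)$ is the unique vector with $\omega(v,R_Q(q))=0$ for all $v\in T_qQ$ and $\omega(q,R_Q(q))=1$; the symplectic polar is $Q^*=\{R_Q(q):q\in Q\}$. Write $a\sim b$ if $a=\lambda b$, $\lambda>0$. For $x$ in the exterior of $M$ let $m_-(x)\in M$ be the unique point with $m_-(x)-x\sim R_M(m_-(x))$, and $T(x)=2m_-(x)-x$ (outer symplectic billiard map). Let $\overline M$ be the symmetrization of $M$, i.e. the boundary of the Minkowski sum of the domain bounded by $M$ and its reflection in the origin (support function $p(v)+p(-v)$ if $p$ is that of $M$), and $N=(\overline M)^*$. Let $H$ be the positively $1$-homogeneous function with $N=\{H=1\}$; it is a norm on $\mathbb{R}^{2d}$. *)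

(* Defs.v *)
From HB Require Import structures.
From mathcomp Require Import all_boot all_order all_algebra.
From mathcomp Require Import all_classical all_reals all_analysis.
Set Implicit Arguments. Unset Strict Implicit. Unset Printing Implicit Defensive.
Import Order.TTheory GRing.Theory Num.Theory.
Import numFieldNormedType.Exports.
Local Open Scope classical_set_scope.
Local Open Scope ring_scope.

Section SymplecticDefs.
Variables (R : realType) (d : nat).

(* R^{2d} as row vectors of length d + d : coordinates (x_1..x_d, y_1..y_d) *)
Definition vec := 'rV[R]_(d + d).

Definition inner (u v : vec) : R := \sum_(i < d + d) u ord0 i * v ord0 i.

Definition Jc (u : vec) : vec := row_mx (- rsubmx u) (lsubmx u).

Definition omega (u v : vec) : R := inner (Jc u) v.

Fixpoint iter_dir (vs : seq vec) (f : vec -> R) : vec -> R :=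
  match vs with
  | [::] => f
  | v :: vs' => fun x => 'D_v (iter_dir vs' f) x
  end.

Definition smooth_on (U : set vec) (f : vec -> R) : Prop :=
  forall (vs : seq vec) (x : vec), U x -> differentiable (iter_dir vs f) x.

Definition hessian_posdef (f : vec -> R) (x : vec) : Prop :=
  forall v : vec, v != 0 -> 0 < 'D_v ('D_v f) x.

Definition boundary (A : set vec) : set vec := closure A `\` interior A.

Definition tangent (Q : set vec) (q v : vec) : Prop :=
  exists gam : R -> vec, gam 0 = q /\ (\forall t \near (0 : R), Q (gam t)) /\
    derivable gam 0 1 /\ 'D_1 gam 0 = v.

Definition is_reeb (Q : set vec) (q r : vec) : Prop :=
  (forall v, tangent Q q v -> omega v r = 0) /\ omega q r = 1.

Definition reeb (Q : set vec) (q : vec) : vec := xget 0 (is_reeb Q q).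

Definition sympl_polar (Q : set vec) : set vec := [set reeb Q q | q in Q].

Definition m_minus (M : set vec) (x : vec) : vec :=
  xget 0 [set m | M m /\ exists2 lam : R, 0 < lam & m - x = lam *: reeb M m].

Definition outer_billiard (M : set vec) (x : vec) : vec :=
  2%:R *: m_minus M x - x.

Definition diff_body (K : set vec) : set vec :=
  [set a - b | a in K & b in K].

(* symmetrization of M = boundary of K + (-K), K the domain bounded by M *)
Definition symmetrization (K : set vec) : set vec := boundary (diff_body K).

End SymplecticDefs.

(* Main.v *)
Require Import Defs.
From HB Require Import structures.
From mathcomp Require Import all_boot all_order all_algebra.
From mathcomp Require Import all_classical all_reals all_analysis.
From mathcomp Require Import lra ring.
Import Order.TTheory GRing.Theory Num.Theory.
Import numFieldNormedType.Exports.
Local Open Scope classical_set_scope.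
Local Open Scope ring_scope.

(** Two steps of the billiard translate [x] by [2 (m2 - m1)], where [m1] and [m2]
    maximise the linear forms [<., J (x - m1)>] and [<., - J (x + m2 - 2 m1)>] on the
    body [K].  The norm [H] is the width [H x = max_(a, b in K) <a - b, J x>], a
    convex function whose gradient at [x] is [- J (a - b)] for maximisers [a, b].
    Because [K] is uniformly convex (positive Hessian plus compactness), maximisers
    depend on the direction in a Lipschitz way, so [m1 - m2] is within [O(1/|x|)]
    of [a - b].  As [<w, J w> = 0], convexity of [H] at [x] and at [T (T x)] bounds
    the change of [H] by [O(1/|x|)], and the change of [H ^ 2] by [O(1)]; for bounded
    [x] the latter is trivial because [m1] and [m2] stay in [K].  The bound is
    then summed along the orbit. *)

Set Implicit Arguments.
Unset Strict Implicit.
Unset Printing Implicit Defensive.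

Lemma cvg_sumr (R : realType) (T : Type) (F : set_system T) {FF : Filter F}
    (I : Type) (r : seq I) (f : I -> T -> R) (l : I -> R) :
  (forall i, f i x @[x --> F] --> l i) ->
  \sum_(i <- r) f i x @[x --> F] --> \sum_(i <- r) l i.
Proof.
move=> fl; elim: r => [|i r IHr].
  by under eq_fun do rewrite big_nil; rewrite big_nil; exact: cvg_cst.
by under eq_fun do rewrite big_cons; rewrite big_cons; exact: cvgD.
Qed.

(** * Inner product, complex structure and the norm of row vectors *)

Section LinearAlgebra.
Variables (R : realType) (d : nat).
Implicit Types u v w : vec R d.

Lemma innerC u v : inner u v = inner v u.
Proof. by apply: eq_bigr => i _; rewrite mulrC. Qed.

Lemma innerDl u v w : inner (u + v) w = inner u w + inner v w.
Proof. by rewrite -big_split; apply: eq_bigr => i _; rewrite mxE mulrDl. Qed.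

Lemma innerZl (t : R) u v : inner (t *: u) v = t * inner u v.
Proof. by rewrite mulr_sumr; apply: eq_bigr => i _; rewrite mxE mulrA. Qed.

Lemma innerDr u v w : inner u (v + w) = inner u v + inner u w.
Proof. by rewrite innerC innerDl !(innerC u). Qed.

Lemma innerZr (t : R) u v : inner u (t *: v) = t * inner u v.
Proof. by rewrite innerC innerZl innerC. Qed.

Lemma innerNl u v : inner (- u) v = - inner u v.
Proof. by rewrite -scaleN1r innerZl mulN1r. Qed.

Lemma innerNr u v : inner u (- v) = - inner u v.
Proof. by rewrite innerC innerNl innerC. Qed.

Lemma inner0l u : inner 0 u = 0.
Proof. by rewrite -(scale0r 0) innerZl mul0r. Qed.

Lemma inner0r u : inner u 0 = 0.
Proof. by rewrite innerC inner0l. Qed.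

Definition innerE :=
  (innerDl, innerDr, innerNl, innerNr, innerZl, innerZr, inner0l, inner0r).

Lemma normv_le (r : R) u : 0 <= r -> (forall i, `|u ord0 i| <= r) -> `|u| <= r.
Proof.
move=> r0 ur; rewrite /Num.Def.normr/= mx_normrE.
by apply: (bigmax_le _ r0) => -[i j] _ /=; rewrite (ord1 i).
Qed.

Lemma coord_le_normv u i : `|u ord0 i| <= `|u|.
Proof.
rewrite [leRHS]/Num.Def.normr/= mx_normrE.
by apply/bigmax_geP; right => /=; exists (ord0, i).
Qed.

Lemma inner_ge0 u : 0 <= inner u u.
Proof. by apply: sumr_ge0 => i _; rewrite -expr2 sqr_ge0. Qed.

(** The norm of [vec] is the max norm, so it is only comparable with the Euclidean one. This bound
    and [inner_le_normv] are the two comparisons used; the factor [(d + d)%:R] enters all later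
    constants through the second. *)
Lemma normv_sqr_le_inner u : `|u| ^+ 2 <= inner u u.
Proof.
rewrite -[leRHS]sqr_sqrtr ?inner_ge0// ler_sqr ?nnegrE ?sqrtr_ge0//.
apply: normv_le => [|i]; first exact: sqrtr_ge0.
rewrite -sqrtr_sqr ler_sqrt ?inner_ge0// /inner (bigD1 i)//= -expr2 lerDl.
by apply: sumr_ge0 => j _; rewrite -expr2 sqr_ge0.
Qed.

Lemma inner_gt0 u : u != 0 -> 0 < inner u u.
Proof.
move=> u0; apply: lt_le_trans (normv_sqr_le_inner u).
by rewrite exprn_gt0// normr_gt0.
Qed.

Lemma inner_eq0 u : inner u u = 0 -> u = 0.
Proof. by move=> u0; apply/eqP; apply: contraPT u0 => /inner_gt0/gt_eqF/eqP. Qed.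

Lemma inner_le_normv u v : `|inner u v| <= (d + d)%:R * `|u| * `|v|.
Proof.
apply: le_trans (ler_norm_sum _ _ _) _.
apply: le_trans (_ : \sum_(i < d + d) `|u| * `|v| <= _).
  by apply: ler_sum => i _; rewrite normrM ler_pM// coord_le_normv.
by rewrite sumr_const card_ord -[X in X <= _]mulr_natl mulrA.
Qed.

Lemma inner_continuous v : continuous (fun u : vec R d => inner u v).
Proof.
move=> u; apply: (@cvg_sumr _ _ (nbhs u)) => i; apply: cvgM; last exact: cvg_cst.
exact: coord_continuous.
Qed.

Lemma JcD u v : Jc (u + v) = Jc u + Jc v.
Proof. by rewrite /Jc add_row_mx !linearD. Qed.

Lemma JcZ (t : R) u : Jc (t *: u) = t *: Jc u.
Proof. by rewrite /Jc scale_row_mx scalerN !linearZ. Qed.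

Lemma JcN u : Jc (- u) = - Jc u.
Proof. by rewrite -scaleN1r JcZ scaleN1r. Qed.

Definition JcE := (JcD, JcZ, JcN).

Lemma JcK u : Jc (Jc u) = - u.
Proof. by rewrite /Jc row_mxKl row_mxKr -opp_row_mx hsubmxK. Qed.

Lemma inner_Jc u v : inner (Jc u) (Jc v) = inner u v.
Proof.
rewrite /inner !big_split_ord /= addrC; congr (_ + _); apply: eq_bigr => i _.
- by rewrite /Jc !row_mxEr !mxE.
- by rewrite /Jc !row_mxEl !mxE mulrNN.
Qed.

Lemma inner_Jcl u v : inner (Jc u) v = - inner u (Jc v).
Proof. by rewrite -[LHS]inner_Jc JcK innerNl. Qed.

Lemma inner_Jc_id u : inner u (Jc u) = 0.
Proof. by have := inner_Jcl u u; rewrite innerC; lra. Qed.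

Lemma normv_Jc u : `|Jc u| = `|u|.
Proof.
have le_J v : `|Jc v| <= `|v|.
  apply: normv_le => // i; rewrite /Jc; case: (split_ordP i) => j ->.
  - by rewrite row_mxEl !mxE normrN coord_le_normv.
  - by rewrite row_mxEr !mxE coord_le_normv.
by apply/le_anti; rewrite le_J/= -[leLHS]normrN -JcK le_J.
Qed.

End LinearAlgebra.

(** * Gradients and a second-order Taylor bound *)

Section Calculus.
Variables (R : realType) (d : nat).
Implicit Types (f : vec R d -> R) (u v x y : vec R d).

Definition grad f x : vec R d := \row_i 'D_(delta_mx ord0 i) f x.

Lemma derive_grad f x v : differentiable f x -> 'D_v f x = inner (grad f x) v.
Proof.
move=> fx; rewrite deriveE// {1}(row_sum_delta v) linear_sum.
by apply: eq_bigr => i _; rewrite linearZ/= mxE deriveE// mulrC.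
Qed.

Lemma is_derive_line f x v (t : R) : differentiable f (x + t *: v) ->
  is_derive t 1 (fun s : R => f (x + s *: v)) ('D_v f (x + t *: v)).
Proof.
move=> fx.
have E : (fun h : R => h^-1 *: ((fun s : R => f (x + s *: v)) (h *: 1 + t) -
    f (x + t *: v))) =
  (fun h : R => h^-1 *: (f (h *: v + (x + t *: v)) - f (x + t *: v))).
  apply/funext => h; congr (_ *: (f _ - _)).
  by rewrite scalerDl [_ *: 1]mulr1 addrCA.
have fv : derivable f (x + t *: v) v by exact: diff_derivable.
by split; move: fv; rewrite /derivable /derive /= E.
Qed.

(** The mean value theorem is applied twice: to [f t - k * t ^+ 2] on [[0, 1]], giving a point [c],
    then to [f1] on [[0, c]], where the lower bound on [f2] absorbs the term [(k + k) * c]. *)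
Lemma taylor_lower (f f1 f2 : R -> R) (k : R) :
  (forall t : R, 0 <= t <= 1 -> is_derive t 1 f (f1 t)) ->
  (forall t : R, 0 <= t <= 1 -> is_derive t 1 f1 (f2 t)) ->
  (forall t : R, 0 <= t <= 1 -> k + k <= f2 t) ->
  f 0 + f1 0 + k <= f 1.
Proof.
move=> f'E f1'E kf2.
pose g t := f t - k * t ^+ 2.
have g'E (t : R) : 0 <= t <= 1 -> is_derive t 1 g (f1 t - (k + k) * t).
  move=> t01; have ? := f'E t t01; apply: is_derive_eq.
  by rewrite /GRing.scale /= !(expr1, mulr1, scale0r, add0r, addr0); ring.
have [||c c01] := @MVT_segment R g (fun t => f1 t - (k + k) * t) 0 1 ler01.
- by move=> s /itvP s01; apply: g'E; rewrite !s01.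
- apply/derivable_within_continuous => s /itvP s01.
  by have [] := g'E s; rewrite ?s01.
rewrite /g expr1n expr0n mulr0 !subr0 !mulr1.
have c0 : 0 <= c by rewrite (itvP c01).
have c1 : c <= 1 by rewrite (itvP c01).
have [||e e0c] := @MVT_segment R f1 f2 0 c c0.
- by move=> s /itvP s01; apply: f1'E; rewrite s01 (le_trans _ c1)// s01.
- apply/derivable_within_continuous => s /itvP s01.
  by have [] := f1'E s; rewrite ?s01 ?(le_trans _ c1)// s01.
rewrite subr0 => f1c fE.
have : k + k <= f2 e by apply: kf2; rewrite (itvP e0c) (le_trans _ c1)// (itvP e0c).
nra.
Qed.

End Calculus.

(** * Local uniform convexity of a smooth function with positive Hessian *)

Section SmoothFunction.
Variables (R : realType) (d : nat) (U : set (vec R d)) (F : vec R d -> R).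
Hypotheses (oU : open U) (sF : smooth_on U F).
Implicit Types u v x y : vec R d.

Lemma smooth_differentiable x : U x -> differentiable F x.
Proof. exact: (sF [::]). Qed.

Lemma smooth_differentiable1 v x : U x -> differentiable ('D_v F) x.
Proof. exact: (sF [:: v]). Qed.

Lemma smooth_differentiable2 u v x : U x -> differentiable ('D_u ('D_v F)) x.
Proof. exact: (sF [:: u; v]). Qed.

Lemma inner_grad_cvg (x : vec R d) (T : Type) (G : set_system T) {GG : Filter G}
    (f g : T -> vec R d) (y : vec R d) : U x ->
  f t @[t --> G] --> x -> g t @[t --> G] --> y ->
  inner (grad F (f t)) (g t) @[t --> G] --> inner (grad F x) y.
Proof.
move=> Ux fx gy; apply: cvg_sumr => i; apply: cvgM; last first.
  exact: (cvg_comp _ (fun v : vec R d => v ord0 i) gy (@coord_continuous _ _ _ _ _ _)).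
rewrite mxE; under eq_fun do rewrite mxE.
exact: (cvg_comp _ ('D_(delta_mx ord0 i) F) fx
  (differentiable_continuous (smooth_differentiable1 _ Ux))).
Qed.

(** Writing the second derivative along [v] as a quadratic form in the second partials makes its
    joint continuity in [x] and [v] immediate. *)
Definition hess x v : R := \sum_i \sum_j
  v ord0 i * (v ord0 j * 'D_(delta_mx ord0 i) ('D_(delta_mx ord0 j) F) x).

Lemma hessE x v : U x -> 'D_v ('D_v F) x = hess x v.
Proof.
move=> Ux; rewrite derive_grad; last exact: smooth_differentiable1.
apply: eq_bigr => i _; rewrite mxE mulrC -mulr_sumr; congr (_ * _).
have near_sum : \forall y \near x,
    'D_v F y = (\sum_j (v ord0 j *: 'D_(delta_mx ord0 j) F)) y.
  near=> y; rewrite derive_grad; last first.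
    by apply: smooth_differentiable; near: y; exact: open_nbhs_nbhs.
  rewrite fct_sumE; apply: eq_bigr => j _.
  by rewrite mxE mulrC.
rewrite (near_eq_derive _ near_sum) derive_sum; last first.
  by move=> j; apply/derivableZ/diff_derivable/smooth_differentiable1.
apply: eq_bigr => j _; rewrite deriveZ//.
by apply/diff_derivable/smooth_differentiable1.
Unshelve. all: by end_near. Qed.

Lemma hessZ x v (t : R) : hess x (t *: v) = t ^+ 2 * hess x v.
Proof.
rewrite mulr_sumr; apply: eq_bigr => i _; rewrite mulr_sumr.
by apply: eq_bigr => j _; rewrite !mxE; ring.
Qed.

Lemma hess_cvg x v (T : Type) (G : set_system T) {GG : Filter G}
    (f g : T -> vec R d) : U x ->
  f t @[t --> G] --> x -> g t @[t --> G] --> v ->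
  hess (f t) (g t) @[t --> G] --> hess x v.
Proof.
move=> Ux fx gv; apply: cvg_sumr => i; apply: cvg_sumr => j.
apply: cvgM; first exact: (cvg_comp _ (fun v : vec R d => v ord0 i) gv
  (@coord_continuous _ _ _ _ _ _)).
apply: cvgM; first exact: (cvg_comp _ (fun v : vec R d => v ord0 j) gv
  (@coord_continuous _ _ _ _ _ _)).
exact: (cvg_comp _ ('D_(delta_mx ord0 i) ('D_(delta_mx ord0 j) F)) fx
  (differentiable_continuous (smooth_differentiable2 _ _ Ux))).
Qed.

(** Joint continuity of [hess] and compactness of the unit sphere give one neighbourhood and one
    constant for all unit vectors; homogeneity of degree two extends the bound to all [v]. *)
Lemma hess_lower_near x : U x -> hessian_posdef F x ->
  exists2 k : R, 0 < k &
    \forall y \near x, forall v, k * `|v| ^+ 2 <= hess y v.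
Proof.
move=> Ux Hx.
pose S := [set v : vec R d | `|v| = 1].
have cS : compact S.
  apply: bounded_closed_compact.
    by exists 1; split => // M M1 v /= ->; exact: ltW.
  apply: (@closed_comp _ _ (fun v : vec R d => `|v|) [set 1]).
    by move=> v _; exact: norm_continuous.
  exact: closed_eq.
(* The covering parameter is a pair of a point near [x] and a constant tending to 0 from the right,
   so that both become uniform over the sphere at once. *)
have /compact_near_coveringP/(_ (vec R d * R)%type
    (filter_prod (nbhs x) ((0 : R)^'+)) (fun p v => p.2 <= hess p.1 v) _) := cS.
case=> [v Sv|[A B] /= [xA B0] ABS].
  have Q0 : 0 < hess x v.
    rewrite -hessE//; apply: Hx; apply/eqP => v0.
    by move: Sv; rewrite /S/= v0 normr0 => /eqP; rewrite eq_sym oner_eq0.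
  have Q2 : hess x v / 2 < hess x v by lra.
  have cQ : hess z.2.1 z.1 @[z --> filter_prod (nbhs v)
      (filter_prod (nbhs x) ((0 : R)^'+))] --> hess x v.
    apply: (@hess_cvg x v _ _ _ (fst \o snd) fst) => //; last exact: cvg_fst.
    exact: (cvg_comp snd fst (@cvg_snd _ _ _ _ _) (@cvg_fst _ _ _ _ _)).
  have P1 : \forall z \near filter_prod (nbhs v)
      (filter_prod (nbhs x) ((0 : R)^'+)), hess x v / 2 < hess z.2.1 z.1.
    exact: (cvgr_gt _ cQ).
  have cK : z.2.2 @[z --> filter_prod (nbhs v) (filter_prod (nbhs x) ((0 : R)^'+))]
      --> (0 : R).
    apply: (cvg_comp snd snd (@cvg_snd _ _ _ _ _)).
    by apply: (cvg_trans (@cvg_snd _ _ _ _ _)); exact: cvg_within.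
  have P2 : \forall z \near filter_prod (nbhs v) (filter_prod (nbhs x) ((0 : R)^'+)),
      z.2.2 < hess x v / 2 by apply: (cvgr_lt _ cK); lra.
  have P3 : filter_prod (nbhs v) (filter_prod (nbhs x) ((0 : R)^'+))
      (fun z => z.2.2 <= hess z.2.1 z.1).
    by apply: filterS2 P1 P2 => z p q; exact: ltW (lt_trans q p).
  exact: P3.
have [k [k0 Bk]] : exists k : R, 0 < k /\ B k.
  have : \forall k \near (0 : R)^'+, 0 < k /\ B k.
    by near=> k; split; [near: k; exact: nbhs_right_gt | near: k].
  by move=> /filter_ex.
exists k => //; apply: filterS xA => y Ay v.
have [->|v0] := eqVneq v 0.
  by rewrite normr0 expr0n mulr0 -[X in hess y X](scale0r (0 : vec R d)) hessZ expr0n mul0r.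
have nv : 0 < `|v| by rewrite normr_gt0.
have /= := ABS (y, k) (conj Ay Bk) (`|v|^-1 *: v).
rewrite hessZ exprVn ler_pdivlMl ?exprn_gt0// mulrC; apply.
by rewrite /S /= normrZ normfV normr_id mulVf ?gt_eqF.
Unshelve. all: by end_near. Qed.

Lemma grad_bounded_near x : U x ->
  exists L : R, \forall y \near x, `|grad F y| <= L.
Proof.
move=> Ux; pose G y i := 'D_(delta_mx ord0 i) F y.
exists (1 + `|grad F x|); near=> y; apply: normv_le => [|i].
  by rewrite addr_ge0.
rewrite mxE; suff : `|G y i - G x i| < 1.
  have := coord_le_normv (grad F x) i; rewrite mxE -/(G x i) -/(G y i) => ? ?.
  rewrite -[G y i](subrK (G x i)); apply: le_trans (ler_normD _ _) _.
  by apply: lerD => //; exact: ltW.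
move: i; near: y; apply: filter_forall => i.
have /cvgrPdist_lt/(_ 1 ltr01) : G y i @[y --> x] --> G x i.
  exact: (differentiable_continuous (smooth_differentiable1 _ Ux)).
by apply: filterS => y; rewrite distrC.
Unshelve. all: by end_near. Qed.

Lemma ball_segment (m x y : vec R d) (r t : R) : ball m r x -> ball m r y ->
  0 <= t <= 1 -> ball m r (x + t *: (y - x)).
Proof.
rewrite -!ball_normE /= => mx my /andP[t0 t1].
have -> : m - (x + t *: (y - x)) = (1 - t) *: (m - x) + t *: (m - y).
  rewrite !scalerBr scalerBl scale1r opprD scalerBl !opprB scale1r.
  by apply/rowP => i; rewrite !mxE; ring.
apply: le_lt_trans (ler_normD _ _) _; rewrite !normrZ !ger0_norm ?subr_ge0//.
have [->|t_neq0] := eqVneq t 0; first by move: mx; lra.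
have tgt0 : 0 < t by rewrite lt_neqAle eq_sym t_neq0.
have p1 : 0 < t * (r - `|m - y|) by rewrite mulr_gt0// subr_gt0.
have p2 : 0 <= (1 - t) * (r - `|m - x|) by rewrite mulr_ge0 ?subr_ge0// ltW.
by move: p1 p2; lra.
Qed.

(** A ball contains the segment joining any two of its points, so the Hessian bound may be
    integrated along it. The Hessian constant is halved because [taylor_lower] asks for [k + k]
    below the second derivative. *)
Lemma strong_convexity_near (x0 : vec R d) : U x0 -> hessian_posdef F x0 ->
  exists r k L : R, [/\ 0 < r, 0 < k, ball x0 r `<=` U,
    forall x y, ball x0 r x -> ball x0 r y ->
      F x + inner (grad F x) (y - x) + k * `|y - x| ^+ 2 <= F y &
    forall x, ball x0 r x -> `|grad F x| <= L].
Proof.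
move=> Ux0 Hx0; have [k k0 Hk] := hess_lower_near Ux0 Hx0.
have [L HL] := grad_bounded_near Ux0.
have : \forall y \near x0, [/\ U y, forall v, k * `|v| ^+ 2 <= hess y v &
    `|grad F y| <= L].
  by near=> y; split; near: y => //; exact: open_nbhs_nbhs.
move=> /nbhs_ballP[r /= r0 Hr].
exists r, (k / 2), L; split; rewrite ?divr_gt0//.
- by move=> y /Hr[].
- move=> x y xr yr; set v := y - x.
  have line t : 0 <= t <= 1 -> U (x + t *: v) /\
      forall w, k * `|w| ^+ 2 <= hess (x + t *: v) w.
    by move=> t01; have [] := Hr _ (ball_segment xr yr t01).
  have := @taylor_lower R (fun t => F (x + t *: v))
    (fun t => 'D_v F (x + t *: v)) (fun t => 'D_v ('D_v F) (x + t *: v))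
    (k / 2 * `|v| ^+ 2).
  have xv : x + v = y by rewrite addrC subrK.
  rewrite scale0r addr0 scale1r xv derive_grad; last first.
    by have [/smooth_differentiable] := line 0 ltac:(by rewrite lexx ler01);
       rewrite scale0r addr0.
  apply=> t /line[Ut Ht].
  + by apply: is_derive_line; exact: smooth_differentiable.
  + by apply: is_derive_line; exact: smooth_differentiable1.
  + by rewrite hessE//; have := Ht v; lra.
- by move=> y /Hr[].
Unshelve. all: by end_near. Qed.

End SmoothFunction.

(** * Normals, tangents and Reeb vectors of general sets *)

Section ConvexSets.
Variables (R : realType) (d : nat).
Implicit Types (D K Q : set (vec R d)) (a b m n q u v x y : vec R d).

Definition is_normal K m n := forall y, K y -> inner y n <= inner m n.

Lemma interior_ball D y : interior D y ->
  exists2 r : R, 0 < r & forall v, `|v| < r -> D (y + v).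
Proof.
move=> /nbhs_ballP[r /= r0 Dr]; exists r => // v vr; apply: Dr.
by rewrite -ball_normE /= opprD addNKr normrN.
Qed.

Lemma small_scale (r : R) v : 0 < r -> exists2 t : R, 0 < t & `|t *: v| < r.
Proof.
move=> r0; have v1 : 0 < 1 + `|v| by rewrite ltr_pwDl.
exists (r / (1 + `|v|)); first by rewrite divr_gt0.
rewrite normrZ ger0_norm; last by rewrite ltW// divr_gt0.
by rewrite mulrAC ltr_pdivrMr// ltr_pM2l// ltr_pwDl.
Qed.

Lemma interior_push D y v : interior D y -> exists2 t : R, 0 < t & D (y + t *: v).
Proof.
by move=> /interior_ball[r /(@small_scale _ v)[t t0 tr] Dr]; exists t; last exact: Dr.
Qed.

Lemma interior_normal_lt K m n y : is_normal K m n -> n != 0 -> interior K y ->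
  inner y n < inner m n.
Proof.
move=> Kn n0 /(interior_push n)[t t0 /Kn]; rewrite innerDl innerZl.
by have := mulr_gt0 t0 (inner_gt0 n0); lra.
Qed.

Lemma boundary_closed D y : closed D -> boundary D y <-> D y /\ ~ interior D y.
Proof. by move=> /closure_id {2}->. Qed.

Lemma normal_boundary D m n : closed D -> D m -> n != 0 -> is_normal D m n ->
  boundary D m.
Proof.
move=> cD Dm n0 Dn; apply/boundary_closed => //; split => // im.
by have := interior_normal_lt Dn n0 im; rewrite ltxx.
Qed.

Lemma segment_continuous a b : continuous (fun t : R => a + t *: b).
Proof. by move=> t; apply: cvgD; [exact: cvg_cst | exact: cvgZr_tmp]. Qed.

(** Off the boundary, belonging to [K] and to its interior coincide, so the parameters of interior
    points are both open and closed in the connected interval [[0, 1]]. *)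
Lemma segment_interior K a b : closed K -> interior K a ->
  (forall t : R, 0 <= t <= 1 -> ~ boundary K (a + t *: (b - a))) ->
  interior K b.
Proof.
move=> cK Ka nb; pose l (t : R) := a + t *: (b - a).
have lc : continuous l by exact: segment_continuous.
have E : `[0, 1]%classic `&` l @^-1` (interior K) = `[0, 1]%classic `&` l @^-1` K.
  apply/seteqP; split=> t [/= t01]; first by move=> /interior_subset.
  move=> Kt; split => //; apply: contrapT => nKt; move: t01; rewrite in_itv/=.
  by move=> /nb; apply; apply/boundary_closed.
have S : `[0, 1]%classic `&` l @^-1` (interior K) = `[0, 1]%classic.
  apply: segment_connected.
  - by exists 0; split; rewrite /= ?in_itv/= ?lexx ?ler01// /l scale0r addr0.
  - exists (l @^-1` (interior K)) => //.
    by apply: open_comp (open_interior _) => t _; exact: lc.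
  - by exists (l @^-1` K) => //; apply: preimage_closed cK => t _; exact: lc.
have : (`[0, 1]%classic : set R) 1 by rewrite /= in_itv/= ler01 lexx.
by rewrite -S => -[_]; rewrite /l /= scale1r addrC subrK.
Qed.

Lemma derive_cvg (g : R -> vec R d) (q v : vec R d) :
  (h^-1 *: (g h - q) @[h --> (0 : R)^'] --> v) ->
  g 0 = q -> derivable g 0 1 /\ 'D_1 g 0 = v.
Proof.
move=> gv g0; have E : (fun h : R => h^-1 *: ((g \o shift 0) (h *: 1) - g 0)) =
    (fun h : R => h^-1 *: (g h - q)).
  by apply/funext => h; rewrite g0 /= addr0 [_ *: 1]mulr1.
by split; rewrite ?/derivable ?/derive E; [exact: cvgP gv | exact: cvg_lim gv].
Qed.

(** Along a curve in [Q] the form given by [n] is maximal at time 0. The curve is defined on both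
    sides of 0, so the one-sided difference quotients bound the derivative from above and from
    below. *)
Lemma tangent_normal K Q q n v : Q `<=` K -> is_normal K q n -> tangent Q q v ->
  inner v n = 0.
Proof.
move=> QK Kn [g [g0 [Qg [dg dgv]]]].
have cg : inner (h^-1 *: (g h - q)) n @[h --> (0 : R)^'] --> inner v n.
  have : h^-1 *: (g h - q) @[h --> (0 : R)^'] --> v.
    rewrite -dgv; have E : (fun h : R => h^-1 *: ((g \o shift 0) (h *: 1) - g 0)) =
        (fun h : R => h^-1 *: (g h - q)).
      by apply/funext => h; rewrite g0 /= addr0 [_ *: 1]mulr1.
    by move: dg; rewrite /derivable /derive E.
  move=> gc; exact: (cvg_comp _ (fun u => inner u n) gc (@inner_continuous _ _ n v)).
have small : \forall h \near (0 : R), inner (g h - q) n <= 0.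
  by apply: filterS Qg => h /QK/Kn; rewrite innerDl innerNl subr_le0.
apply/eqP; rewrite eq_le; apply/andP; split.
- have cr := cvg_dnbhs_at_right cg; rewrite -(cvg_lim _ cr)//.
  apply: limr_le; first exact: cvgP cr.
  near=> h; rewrite innerZl mulr_ge0_le0 ?invr_ge0//.
  by near: h; exact: cvg_within small.
- have cl := cvg_dnbhs_at_left cg; rewrite -(cvg_lim _ cl)//.
  apply: limr_ge; first exact: cvgP cl.
  near=> h; rewrite innerZl mulr_le0 ?invr_le0//.
  by near: h; exact: cvg_within small.
Unshelve. all: by end_near. Qed.

(** Since [reeb] is a choice, uniqueness must be proved too: the tangent hyperplane and [q] together
    span the space, and [omega] is nondegenerate. *)
Lemma reeb_normal Q q n : (forall v, tangent Q q v <-> inner v n = 0) ->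
  0 < inner q n -> reeb Q q = (inner q n)^-1 *: Jc n.
Proof.
move=> Qn qn; set r := _ *: _.
have Qr : is_reeb Q q r.
  rewrite /r; split => [v /Qn vn|]; rewrite /omega innerZr inner_Jc.
    by rewrite vn mulr0.
  by rewrite mulVf// gt_eqF.
have [Q0 Q1] := Qr.
have [R0 R1] : is_reeb Q q (reeb Q q) by apply: xgetPex; exists r.
apply/subr0_eq; set s := _ - _.
have s0 v : inner (Jc v) s = 0.
  (* Subtracting [e *: q] projects [v] to the tangent hyperplane along [q]. *)
  set e := inner v n / inner q n.
  have : tangent Q q (v - e *: q).
    by apply/Qn; rewrite !innerE /e divfK ?subrr// gt_eqF.
  move=> /[dup]/R0 + /Q0; move: R1 Q1; rewrite /omega /s !(JcE, innerE).
  by move=> -> ->; lra.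
by apply: inner_eq0; have := s0 (- Jc s); rewrite JcN JcK opprK.
Qed.

(* The curve is the radial projection of the line [q + t *: v] to the boundary:
   the supporting hyperplane keeps the line outside, and the last hypothesis
   makes the distance to the boundary [o(t)]. *)
Lemma tangent_radial D q n v : closed D ->
  (forall y (r : R), D y -> 0 <= r < 1 -> interior D (r *: y)) ->
  D q -> is_normal D q n -> 0 < inner q n -> inner v n = 0 ->
  (forall e : R, 0 < e ->
     \forall t \near (0 : R), D ((1 - e * `|t|) *: (q + t *: v))) ->
  tangent (boundary D) q v.
Proof.
move=> cD starD Dq Dn qn vn line.
have n0 : n != 0 by apply: contraTneq qn => ->; rewrite inner0r ltxx.
(* Otherwise the segment from 0 to [q + t *: v] would miss the boundary and end at an interior
   point, although that point lies on the supporting hyperplane. *)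
have bdE : forall t : R, exists s : R,
    0 <= s <= 1 /\ boundary D ((1 - s) *: (q + t *: v)).
  move=> t; apply: contrapT => nex.
  have i0 : interior D 0.
    by rewrite -(scale0r q); apply: starD; rewrite ?lexx ?ltr01.
  have : interior D (q + t *: v).
    apply: (segment_interior cD i0) => s /andP[s0 s1] bs; apply: nex.
    exists (1 - s); split; first by lra.
    by move: bs; rewrite add0r subr0 subKr.
  by move=> /(interior_normal_lt Dn n0); rewrite !innerE vn; lra.
have [s sE] := choice bdE.
(* The function [s] is an arbitrary choice; star-shapedness still bounds it by any shrinking factor
   that brings the point into [D]. *)
have s_le (t : R) (e : R) : D ((1 - e) *: (q + t *: v)) -> 0 <= e -> s t <= e.
  move=> De e0; rewrite leNgt; apply/negP => est.
  have [/andP[s0 s1] /boundary_closed-/(_ cD)[_]] := sE t; apply.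
  have e1 : 0 < 1 - e by lra.
  have -> : (1 - s t) *: (q + t *: v) =
      ((1 - s t) / (1 - e)) *: ((1 - e) *: (q + t *: v)).
    by rewrite scalerA divfK ?gt_eqF.
  apply: starD => //; rewrite divr_ge0 ?(ltW e1) ?subr_ge0//=.
  by rewrite ltr_pdivrMr// mul1r; lra.
pose g (t : R) := (1 - s t) *: (q + t *: v).
have g0 : g 0 = q.
  have : s 0 <= 0 by apply: s_le; rewrite ?lexx// scale0r addr0 subr0 scale1r.
  have [/andP[s0 _] _] := sE 0 => ?; have -> : g 0 = (1 - 0) *: (q + 0 *: v).
    by congr ((1 - _) *: _); apply/le_anti/andP.
  by rewrite subr0 scale1r scale0r addr0.
exists g; split => //; split.
  by near=> t; exact: (sE t).2.
apply: (derive_cvg _ g0); apply/cvgrPdist_le => e e0.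
(* [C] bounds [q + h *: v] when [h] has absolute value at most 1. The error of the difference
   quotient is [(h^-1 * s h) *: (q + h *: v)], which is why [line] is used with [e / C]. *)
pose C := 1 + `|q| + `|v|.
have C0 : 0 < C by rewrite /C -addrA ltr_pwDl// addr_ge0.
near=> h.
have h0 : h != 0 by near: h; exact: nbhs_dnbhs_neq.
have -> : v - h^-1 *: (g h - q) = (h^-1 * s h) *: (q + h *: v).
  by apply/rowP => i; rewrite !mxE; field.
have hD : D ((1 - e / C * `|h|) *: (q + h *: v)).
  by near: h; apply: nbhs_dnbhs; apply: line; rewrite divr_gt0.
have h1 : `|h| <= 1 by near: h; exact: dnbhs0_le.
have [/andP[s0 _] _] := sE h.
have sh := s_le _ _ hD (mulr_ge0 (divr_ge0 (ltW e0) (ltW C0)) (normr_ge0 h)).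
have qC : `|q + h *: v| <= C.
  apply: le_trans (ler_normD _ _) _; rewrite normrZ /C.
  have : `|h| * `|v| <= `|v| by rewrite ler_piMl.
  by lra.
rewrite normrZ normrM normfV -mulrA ler_pdivrMl ?normr_gt0// (ger0_norm s0).
apply: le_trans (ler_pM s0 (normr_ge0 _) sh qC) _.
by rewrite mulrAC divfK ?gt_eqF// mulrC.
Unshelve. all: by end_near. Qed.

End ConvexSets.

(** The Banach fixed point theorem in [tangency_point_exists] requires a complete normed space. *)
HB.instance Definition _ (R : realType) (n : nat) := Complete.on 'rV[R]_n.

(** * The strictly convex body and its defining function *)

Section ConvexBody.
Variables (R : realType) (d : nat) (K U : set (vec R d)) (F : vec R d -> R) (c : R).
Hypotheses (cK : closed K) (bK : bounded_set K).
Hypothesis strictK : forall a b : vec R d, K a -> K b -> a != b ->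
  forall t : R, 0 < t -> t < 1 -> interior K (t *: a + (1 - t) *: b).
Hypothesis K0 : interior K 0.
Hypotheses (oU : open U) (MU : boundary K `<=` U) (sF : smooth_on U F).
Hypothesis pF : forall x, U x -> hessian_posdef F x.
Hypothesis ME : boundary K = [set q | U q /\ F q = c].
Implicit Types a b m n q u v w x y z : vec R d.

Lemma interior_segment a b (t : R) : interior K a -> K b -> 0 <= t < 1 ->
  interior K (a + t *: (b - a)).
Proof.
move=> Ka Kb /andP[t0 t1].
have [ab|ab] := eqVneq a b; first by rewrite -ab subrr scaler0 addr0.
have [->|tn0] := eqVneq t 0; first by rewrite scale0r addr0.
have tgt0 : 0 < t by rewrite lt_neqAle eq_sym tn0.
have -> : a + t *: (b - a) = (1 - t) *: a + (1 - (1 - t)) *: b.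
  by apply/rowP => i; rewrite !mxE; ring.
by apply: strictK => //; [exact: interior_subset | lra | lra].
Qed.

Lemma body_segment a b (t : R) : K a -> K b -> 0 <= t <= 1 -> K (a + t *: (b - a)).
Proof.
move=> Ka Kb /andP[t0 t1].
have [ab|ab] := eqVneq a b; first by rewrite -ab subrr scaler0 addr0.
have [->|tn0] := eqVneq t 0; first by rewrite scale0r addr0.
have [->|tn1] := eqVneq t 1; first by rewrite scale1r addrC subrK.
have -> : a + t *: (b - a) = t *: b + (1 - t) *: a.
  by apply/rowP => i; rewrite !mxE; ring.
have tgt0 : 0 < t by rewrite lt_neqAle eq_sym tn0.
have tlt1 : t < 1 by rewrite lt_neqAle tn1.
by apply: interior_subset; apply: strictK => //; rewrite eq_sym.
Qed.

Lemma interior_scale y (r : R) : K y -> 0 <= r < 1 -> interior K (r *: y).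
Proof.
by move=> Ky r01; have := interior_segment K0 Ky r01; rewrite subr0 add0r.
Qed.

Lemma boundaryP y : boundary K y <-> K y /\ ~ interior K y.
Proof. exact: boundary_closed. Qed.

(** * Local geometry in a ball where [F] is uniformly convex *)

Section Chart.
Variables (x0 : vec R d) (r k : R).
Hypotheses (k0 : 0 < k) (BU : ball x0 r `<=` U).
Hypothesis Fconv : forall x y, ball x0 r x -> ball x0 r y ->
  F x + inner (grad F x) (y - x) + k * `|y - x| ^+ 2 <= F y.

Lemma chart_nbhs y : ball x0 r y -> nbhs y (ball x0 r).
Proof. by move=> By; apply: open_nbhs_nbhs; split => //; exact: ball_open. Qed.

(** On this half-space the convexity inequality at [m] forces [F y] above the level [c]. *)
Lemma chart_above m y : boundary K m -> ball x0 r m -> ball x0 r y -> y != m ->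
  0 <= inner (grad F m) (y - m) -> ~ boundary K y.
Proof.
rewrite ME => -[_ Fm] Bm By ym gym [_ Fy].
have := Fconv Bm By; rewrite Fm Fy.
have : 0 < k * `|y - m| ^+ 2 by rewrite mulr_gt0// exprn_gt0// normr_gt0 subr_eq0.
by lra.
Qed.

(** The gradient is not yet known to be nonzero, so its vanishing is a separate case. The vector [e]
    certifies that [v] and [w] are independent, which keeps the segments used in
    [chart_interior_below] away from [m]. *)
Lemma chart_transverse m y : boundary K m -> ball x0 r m -> ball x0 r y ->
  interior K y -> 0 <= inner (grad F m) (y - m) ->
  exists w v e, [/\ interior K (m + w) /\ ball x0 r (m + w),
    0 <= inner (grad F m) w, v != 0 /\ inner (grad F m) v = 0,
    0 < inner e w & inner e v = 0].
Proof.
move=> Mm Bm By Ky gy; set g := grad F m in gy *.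
have [_ nKm] := (boundaryP m).1 Mm.
have ym : y - m != 0 by rewrite subr_eq0; apply: contra_notN nKm => /eqP <-.
have [g0|g0] := eqVneq g 0.
  exists (y - m), (Jc (y - m)), (y - m); rewrite g0 !inner0l addrC subrK.
  split => //; [split => // | exact: inner_gt0 | exact: inner_Jc_id].
  by rewrite -normr_eq0 normv_Jc normr_eq0.
have [t t0 [Kt Bt]] : exists2 t : R, 0 < t &
    (interior K `&` ball x0 r) (y + t *: g).
  by apply: interior_push; apply: filterI; [exact: nbhs_interior | exact: chart_nbhs].
have E : m + (y - m + t *: g) = y + t *: g by rewrite addrA (addrC m) subrK.
have gw : 0 < inner g (y - m + t *: g).
  by rewrite innerDr innerZr; have := mulr_gt0 t0 (inner_gt0 g0); lra.
exists (y - m + t *: g), (Jc g), g; rewrite E inner_Jc_id.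
split => //; first exact: ltW.
by split => //; rewrite -normr_eq0 normv_Jc normr_eq0.
Qed.

(* If the closed half-space met the interior, it would contain two segments,
   disjoint from the boundary, ending at two points symmetric about [m]. *)
Lemma chart_interior_below m y : boundary K m -> ball x0 r m -> ball x0 r y ->
  interior K y -> inner (grad F m) (y - m) < 0.
Proof.
move=> Mm Bm By Ky; rewrite ltNge; apply/negP => gy.
have [w [v [e [[Kw Bw] gw [v0 gv] ew ev]]]] := chart_transverse Mm Bm By Ky gy.
have [_ nKm] := (boundaryP m).1 Mm.
have [rho rho0 Brho] : exists2 rho : R, 0 < rho &
    forall u, `|u| < rho -> ball x0 r (m + u).
  exact: interior_ball (chart_nbhs Bm).
have [t t0 tv] := small_scale v rho0.
have end_in (s : R) : s != 0 -> `|s *: v| < rho -> interior K (m + s *: v).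
  move=> s0 sv; apply: (segment_interior cK Kw) => l l01.
  have E : m + w + l *: (m + s *: v - (m + w)) - m = (1 - l) *: w + (l * s) *: v.
    by apply/rowP => i; rewrite !mxE; ring.
  have /andP[l0 l1] := l01.
  apply: (chart_above Mm Bm).
  - exact: ball_segment Bw (Brho _ sv) l01.
  - rewrite -subr_eq0 E; apply/eqP => E0.
    have : inner e ((1 - l) *: w + (l * s) *: v) = 0 by rewrite E0 inner0r.
    rewrite !innerE ev mulr0 addr0 => /eqP; rewrite mulf_eq0 (gt_eqF ew) orbF.
    rewrite subr_eq0 => /eqP l1'; move/eqP: E0; rewrite -l1' subrr scale0r add0r mul1r.
    by rewrite scaler_eq0 (negPf s0) (negPf v0).
  - by rewrite E !innerE gv mulr0 addr0 mulr_ge0// subr_ge0.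
apply: nKm; have Kp := end_in t (lt0r_neq0 t0) tv.
have Kn : interior K (m + (- t) *: v).
  by apply: end_in; rewrite ?oppr_eq0 ?lt0r_neq0// scaleNr normrN.
have := interior_segment Kp (interior_subset Kn) (_ : 0 <= 2^-1 < 1).
have -> : m + t *: v + 2^-1 *: (m + - t *: v - (m + t *: v)) = m.
  by apply/rowP => i; rewrite !mxE; field.
by apply; lra.
Qed.

(** Sliding [y] towards [m] brings it into the ball, keeps it interior, and multiplies the inner
    product by a positive factor. *)
Lemma chart_inner_grad_lt m y : boundary K m -> ball x0 r m -> interior K y ->
  inner (grad F m) (y - m) < 0.
Proof.
move=> Mm Bm Ky.
have [rho rho0 Brho] : exists2 rho : R, 0 < rho &
    forall u, `|u| < rho -> ball x0 r (m + u).
  exact: interior_ball (chart_nbhs Bm).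
have [t t0 tv] := small_scale (y - m) rho0.
have [s [s0 s1 st]] : exists s : R, [/\ 0 < s, s < 1 & s <= t].
  exists (t / (1 + t)); split; first by rewrite divr_gt0// addr_gt0.
  - by rewrite ltr_pdivrMr ?addr_gt0// mul1r ltrDr.
  - by rewrite ler_pdivrMr ?addr_gt0//; nra.
have := chart_interior_below (y := m + s *: (y - m)) Mm Bm.
rewrite [m + _]addrC addrK innerZr pmulr_rlt0//; apply.
  rewrite addrC; apply: Brho; apply: le_lt_trans tv; rewrite !normrZ.
  by apply: ler_wpM2r => //; rewrite (gtr0_norm s0) (gtr0_norm t0).
have -> : s *: (y - m) + m = y + (1 - s) *: (m - y).
  by apply/rowP => i; rewrite !mxE; ring.
by apply: interior_segment => //; [exact: ((boundaryP m).1 Mm).1 | lra].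
Qed.

Lemma chart_inner_grad_gt0 m : boundary K m -> ball x0 r m ->
  0 < inner (grad F m) m.
Proof.
by move=> Mm Bm; have := chart_inner_grad_lt Mm Bm K0; rewrite sub0r innerNr; lra.
Qed.

(** A point of [K] beyond the hyperplane through [m] could be scaled back onto it; the result would
    be interior, against the strict inequality of [chart_inner_grad_lt]. *)
Lemma chart_grad_normal m : boundary K m -> ball x0 r m -> is_normal K m (grad F m).
Proof.
move=> Mm Bm y Ky; rewrite !(innerC _ (grad F m)) leNgt; apply/negP => gy.
have gm := chart_inner_grad_gt0 Mm Bm; have gy0 := lt_trans gm gy.
have : interior K ((inner (grad F m) m / inner (grad F m) y) *: y).
  apply: interior_scale => //; rewrite divr_ge0 ?ltW//=.
  by rewrite ltr_pdivrMr// mul1r.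
move=> /(chart_inner_grad_lt Mm Bm).
by rewrite innerDr innerNr innerZr divfK ?gt_eqF// subrr ltxx.
Qed.

(** Move from [m] slightly towards 0: by continuity the gradient there still has positive product
    with [m], so [F] has decreased. This settles which side of the level [c] is inside. *)
Lemma chart_interior_point m : boundary K m -> ball x0 r m ->
  exists p, [/\ ball x0 r p, interior K p & F p < c].
Proof.
move=> Mm Bm; have gm := chart_inner_grad_gt0 Mm Bm.
have [Km _] := (boundaryP m).1 Mm; have Um := BU Bm.
have cl : (m - t *: m) @[t --> (0 : R)^'+] --> m.
  rewrite -[X in _ --> X]subr0 -(scale0r m).
  apply: cvgB; first exact: cvg_cst.
  by apply: cvgZr_tmp; exact: cvg_within.
have cg : inner (grad F (m - t *: m)) m @[t --> (0 : R)^'+] --> inner (grad F m) m.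
  by apply: (inner_grad_cvg sF Um cl); exact: cvg_cst.
have : \forall t \near (0 : R)^'+, exists p, [/\ ball x0 r p, interior K p & F p < c].
  near=> t; exists (m - t *: m).
  have t0 : 0 < t by near: t; exact: nbhs_right_gt.
  have Bp : ball x0 r (m - t *: m).
    by near: t; exact: (cl _ (chart_nbhs Bm)).
  split => //.
  - have -> : m - t *: m = (1 - t) *: m by rewrite scalerBl scale1r.
    apply: interior_scale => //; apply/andP; split; last by lra.
    by rewrite subr_ge0; near: t; exact: nbhs_right_le.
  - have gp : 0 < inner (grad F (m - t *: m)) m.
      by near: t; exact: (cvgr_gt _ cg).
    move: Mm; rewrite ME => -[_ Fm]; have := Fconv Bp Bm; rewrite Fm.
    rewrite subKr innerZr.
    have := mulr_gt0 t0 gp.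
    have : 0 <= k * `|t *: m| ^+ 2 by rewrite mulr_ge0 ?exprn_ge0// ltW.
    by lra.
by move=> /filter_ex[].
Unshelve. all: by end_near. Qed.

Lemma chart_convex x y (t : R) : ball x0 r x -> ball x0 r y -> 0 <= t <= 1 ->
  F (x + t *: (y - x)) <= (1 - t) * F x + t * F y.
Proof.
move=> Bx By t01; have Bz := ball_segment Bx By t01.
set z := x + _ in Bz *; have /andP[t0 t1] := t01.
have zx : x - z = - (t *: (y - x)) by rewrite opprD addNKr.
have zy : y - z = (1 - t) *: (y - x).
  by apply/rowP => i; rewrite !mxE; ring.
have pos u : 0 <= k * `|u| ^+ 2 by rewrite mulr_ge0 ?exprn_ge0// ltW.
have Fx : 0 <= F x - F z + t * inner (grad F z) (y - x).
  have := Fconv Bz Bx; have := pos (x - z); rewrite zx innerNr innerZr.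
  by lra.
have Fy : 0 <= F y - F z - (1 - t) * inner (grad F z) (y - x).
  have := Fconv Bz By; have := pos (y - z); rewrite zy innerZr.
  by lra.
have := mulr_ge0 t0 Fy; have : 0 <= 1 - t by lra.
by move=> /mulr_ge0/(_ Fx); lra.
Qed.

(** By convexity [F] stays below [c] on the segment from an interior point with smaller value, so
    that segment never meets the boundary. *)
Lemma chart_sublevel m y : boundary K m -> ball x0 r m -> ball x0 r y ->
  F y < c -> interior K y.
Proof.
move=> Mm Bm By Fy; have [p [Bp Kp Fp]] := chart_interior_point Mm Bm.
apply: (segment_interior cK Kp) => t t01; rewrite ME => -[_].
have := chart_convex Bp By t01 => /[swap] ->; have /andP[t0 t1] := t01.
have [->|tn0] := eqVneq t 0; first by lra.
have : 0 < t * (c - F y) by rewrite mulr_gt0 ?subr_gt0// lt_neqAle eq_sym tn0.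
have : 0 <= (1 - t) * (c - F p) by rewrite mulr_ge0 ?subr_ge0// ltW.
by lra.
Qed.

(** If [F y] exceeded [c], the segment from an interior point [p] with [F p < c] would cross the
    level [c] before [y], at a point both interior and on the boundary. *)
Lemma chart_body_le m y : boundary K m -> ball x0 r m -> ball x0 r y -> K y ->
  F y <= c.
Proof.
move=> Mm Bm By Ky; have [p [Bp Kp Fp]] := chart_interior_point Mm Bm.
rewrite leNgt; apply/negP => Fy.
have [t t01 Ft] : exists2 t, t \in `[0, 1]%R & F (p + t *: (y - p)) = c.
  apply: (@IVT R (fun t => F (p + t *: (y - p)))); first exact: ler01.
    apply/derivable_within_continuous => t; rewrite in_itv/= => t01.
    have Ut := BU (ball_segment Bp By t01).
    by have [] := is_derive_line (smooth_differentiable sF Ut).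
  rewrite scale0r addr0 scale1r [p + _]addrC subrK.
  by rewrite ge_min (ltW Fp)/= le_max (ltW Fy) orbT.
move: t01; rewrite in_itv/= => t01; have /andP[t0 t1] := t01.
have [t1'|tn1] := eqVneq t 1.
  by move: Ft Fy; rewrite t1' scale1r [p + _]addrC subrK => ->; rewrite ltxx.
have Kz : interior K (p + t *: (y - p)).
  by apply: interior_segment => //; rewrite t0 lt_neqAle tn1.
have : boundary K (p + t *: (y - p)).
  by rewrite ME; split => //; apply: BU; exact: ball_segment.
by move=> /boundaryP[_]; apply.
Qed.

Lemma chart_strong_normal m y : boundary K m -> ball x0 r m -> ball x0 r y -> K y ->
  k * `|m - y| ^+ 2 <= inner (m - y) (grad F m).
Proof.
move=> Mm Bm By Ky; have Fy := chart_body_le Mm Bm By Ky.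
have := Fconv Bm By; move: Mm; rewrite ME => -[_ ->].
by rewrite (distrC m) [inner (m - y) _]innerC -[m - y]opprB innerNr; lra.
Qed.

(** A tangential move by [t *: v] raises [F] by [o(t)] only, and a pull of order [e * |t|] against
    [w] outweighs this. Taking [w = a] serves [tangent_radial] for [K]; [w = a - b] serves it for
    the difference body. *)
Lemma chart_contact a v w (e : R) : boundary K a -> ball x0 r a ->
  inner (grad F a) v = 0 -> 0 < inner (grad F a) w -> 0 < e ->
  \forall t \near (0 : R), K (a + t *: v - (e * `|t|) *: (w + t *: v)).
Proof.
move=> Ma Ba gv gw e0; have Ua := BU Ba; have [Ka _] := (boundaryP a).1 Ma.
pose z (t : R) := a + t *: v - (e * `|t|) *: (w + t *: v).
have cid : (t : R) @[t --> (0 : R)] --> (0 : R) by exact: cvg_id.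
have cn : e * `|t| @[t --> (0 : R)] --> (0 : R).
  by rewrite -[X in _ --> X](mulr0 e) -[X in e * X](@normr0 _ R); apply: cvgM;
     [exact: cvg_cst | exact: cvg_norm].
have cv : t *: v @[t --> (0 : R)] --> (0 : vec R d).
  by rewrite -(scale0r v); exact: cvgZr_tmp.
have cz : z t @[t --> (0 : R)] --> a.
  suff : z t @[t --> (0 : R)] --> a + 0 - 0 *: (w + 0).
    by rewrite scale0r subr0 addr0.
  apply: cvgB; first by apply: cvgD => //; exact: cvg_cst.
  by apply: cvgZ => //; apply: cvgD => //; exact: cvg_cst.
have cgw : inner (grad F (z t)) w @[t --> (0 : R)] --> inner (grad F a) w.
  by apply: (inner_grad_cvg sF Ua cz); exact: cvg_cst.
have cgv : inner (grad F (z t)) v @[t --> (0 : R)] --> (0 : R).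
  suff : inner (grad F (z t)) v @[t --> (0 : R)] --> inner (grad F a) v by rewrite gv.
  by apply: (inner_grad_cvg sF Ua cz); exact: cvg_cst.
(* After multiplication by [|t|] this is a lower bound for [inner (grad F (z t)) (a - z t)]. The
   convexity inequality is based at [z t], so the gradient is taken there. *)
have key : e * inner (grad F (z t)) w -
    `|inner (grad F (z t)) v| * (1 + e * `|t|) @[t --> (0 : R)] -->
    e * inner (grad F a) w - `|0 : R| * (1 + 0).
  apply: cvgB; first by apply: cvgM => //; exact: cvg_cst.
  by apply: cvgM; [exact: cvg_norm | apply: cvgD => //; exact: cvg_cst].
near=> t.
have Bz : ball x0 r (z t).
  by near: t; exact: (cz _ (chart_nbhs Ba)).
have keyt : 0 < e * inner (grad F (z t)) w -
    `|inner (grad F (z t)) v| * (1 + e * `|t|).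
  by near: t; apply: (cvgr_gt _ key); rewrite normr0 mul0r subr0 mulr_gt0.
have [->|t0] := eqVneq t 0.
  by rewrite normr0 mulr0 !scale0r subr0 addr0.
apply: interior_subset; apply: (chart_sublevel Ma Ba Bz).
have := Fconv Bz Ba; have [_ ->] : U a /\ F a = c by move: Ma; rewrite ME.
have -> : a - z t = (e * `|t|) *: w + (e * `|t| * t - t) *: v.
  by apply/rowP => i; rewrite !mxE; ring.
have : 0 <= k * `|(e * `|t|) *: w + (e * `|t| * t - t) *: v| ^+ 2.
  by rewrite mulr_ge0 ?exprn_ge0// ltW.
rewrite innerDr !innerZr; set gW := inner _ w in keyt *; set gV := inner _ v in keyt *.
have tp : 0 < `|t| by rewrite normr_gt0.
have : - (e * `|t| * t - t) * gV <= `|t| * (`|gV| * (1 + e * `|t|)).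
  have -> : - (e * `|t| * t - t) * gV = t * gV * (1 - e * `|t|) by ring.
  have et : 0 <= e * `|t| by rewrite mulr_ge0// ltW.
  apply: le_trans (ler_norm _) _; rewrite !normrM -mulrA.
  do 2!apply: ler_wpM2l => //.
  by apply: le_trans (ler_normB _ _) _; rewrite normr1 (ger0_norm et).
by have := mulr_gt0 tp keyt; lra.
Unshelve. all: by end_near. Qed.

End Chart.

(** * Normal cones, Reeb vectors and uniform convexity of the whole boundary *)

Lemma chart_at m : boundary K m -> exists r k L : R,
  [/\ 0 < r, 0 < k, ball m r `<=` U,
    forall x y, ball m r x -> ball m r y ->
      F x + inner (grad F x) (y - x) + k * `|y - x| ^+ 2 <= F y &
    forall x, ball m r x -> `|grad F x| <= L].
Proof. by move=> /MU Um; apply: strong_convexity_near => //; exact: pF. Qed.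

Lemma grad_inner_gt0 m : boundary K m -> 0 < inner (grad F m) m.
Proof.
move=> Mm; have [r [k [L [r0 k0 BU Fc _]]]] := chart_at Mm.
by apply: (chart_inner_grad_gt0 k0 Fc) => //; exact: ballxx.
Qed.

Lemma grad_normal m : boundary K m -> is_normal K m (grad F m).
Proof.
move=> Mm; have [r [k [L [r0 k0 BU Fc _]]]] := chart_at Mm.
by apply: (chart_grad_normal k0 Fc) => //; exact: ballxx.
Qed.

Lemma contact a v w (e : R) : boundary K a ->
  inner (grad F a) v = 0 -> 0 < inner (grad F a) w -> 0 < e ->
  \forall t \near (0 : R), K (a + t *: v - (e * `|t|) *: (w + t *: v)).
Proof.
move=> Mm; have [r [k [L [r0 k0 BU Fc _]]]] := chart_at Mm.
by apply: (chart_contact k0 BU Fc) => //; exact: ballxx.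
Qed.

Lemma tangent_boundaryP m v : boundary K m ->
  tangent (boundary K) m v <-> inner v (grad F m) = 0.
Proof.
move=> Mm; have [Km _] := (boundaryP m).1 Mm; split => [|gv].
  by apply: tangent_normal (grad_normal Mm) => y /boundaryP[].
apply: (tangent_radial (n := grad F m)) => //.
- exact: interior_scale.
- exact: grad_normal.
- by rewrite innerC; exact: grad_inner_gt0.
- move=> e e0; rewrite innerC in gv.
  have := contact Mm gv (grad_inner_gt0 Mm) e0; apply: filterS => t.
  by rewrite scalerBl scale1r.
Qed.

Lemma normal_inner_gt0 (D : set (vec R d)) m n : interior D 0 -> is_normal D m n -> n != 0 ->
  0 < inner m n.
Proof. by move=> D0 Dn n0; have := interior_normal_lt Dn n0 D0; rewrite inner0l. Qed.

(** The part of [n] orthogonal to the gradient is tangent, hence orthogonal to [n] as well, hence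
    zero. The factor is positive because 0 is interior. *)
Lemma normal_cone m n : boundary K m -> is_normal K m n -> n != 0 ->
  exists2 b : R, 0 < b & n = b *: grad F m.
Proof.
move=> Mm Kn n0; have gm := grad_inner_gt0 Mm; set g := grad F m in gm *.
have g0 : g != 0 by apply: contraTneq gm => ->; rewrite inner0l ltxx.
pose b := inner n g / inner g g; have gg := inner_gt0 g0.
have vg : inner (n - b *: g) g = 0.
  by rewrite innerDl innerNl innerZl divfK ?subrr// gt_eqF.
have vn : inner (n - b *: g) n = 0.
  apply: (tangent_normal _ Kn); last by apply/(tangent_boundaryP _ Mm); exact: vg.
  by move=> y /boundaryP[].
have nE : n = b *: g.
  by apply/subr0_eq/inner_eq0; rewrite innerDr innerNr innerZr vn vg mulr0 subr0.
exists b => //; have := normal_inner_gt0 K0 Kn n0.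
by rewrite nE innerZr innerC pmulr_lgt0.
Qed.

Lemma reeb_boundary m n : boundary K m -> is_normal K m n -> n != 0 ->
  reeb (boundary K) m = (inner m n)^-1 *: Jc n.
Proof.
move=> Mm Kn n0; apply: reeb_normal; last exact: normal_inner_gt0 Kn n0.
have [b b0 nE] := normal_cone Mm Kn n0.
move=> v; rewrite tangent_boundaryP// nE innerZr; split => [->|/eqP].
  by rewrite mulr0.
by rewrite mulf_eq0 gt_eqF//= => /eqP.
Qed.

Lemma body_bounded : exists2 rho : R, 0 < rho & forall y, K y -> `|y| <= rho.
Proof.
have [M [_ HM]] := bK; exists (`|M| + 1); first by rewrite ltr_wpDl.
by apply: HM; rewrite (le_lt_trans (ler_norm M))// ltrDl.
Qed.

Lemma boundary_compact : compact (boundary K).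
Proof.
apply: (subclosed_compact _ (bounded_closed_compact bK cK)) => [|y /boundaryP[]//].
have -> : boundary K = K `&` ~` (interior K).
  by apply/seteqP; split => y; rewrite boundaryP.
by apply: closedI => //; apply: open_closedC; exact: open_interior.
Qed.

(** [chart_strong_normal] gives the bound near each boundary point, and compactness makes the
    constant uniform. A distant [y] is replaced by a point of the segment from [m] to [y] close to
    [m]. *)
Lemma uniformly_convex : exists2 kap : R, 0 < kap & forall m n y, boundary K m ->
  is_normal K m n -> K y -> kap * `|n| * `|m - y| ^+ 2 <= inner (m - y) n.
Proof.
have [rho rho0 Krho] := body_bounded.
pose P (kap : R) (m : vec R d) := boundary K m -> forall n y, is_normal K m n ->
  K y -> kap * `|n| * `|m - y| ^+ 2 <= inner (m - y) n.
have : \forall kap \near (0 : R)^'+, boundary K `<=` P kap.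
  have /compact_near_coveringP := boundary_compact; apply => x Mx.
  have [r [k [L [r0 k0 BU Fc gL]]]] := chart_at Mx.
  pose s := r / 2 / (r / 2 + 2 * rho + 1).
  have den : 0 < r / 2 + 2 * rho + 1 by rewrite !addr_gt0 ?divr_gt0 ?mulr_gt0.
  (* Since [K] has diameter at most [2 * rho], the fraction [s] of any segment in [K] is shorter
     than [r / 2]. The bound [1 + |L|] on the gradient then turns the constant [k * s] into one
     normalised by the length of [n]. *)
  have s0 : 0 < s by rewrite !divr_gt0.
  have L0 : 0 < 1 + `|L| by rewrite ltr_pwDl.
  exists (ball x (r / 2), [set kap | 0 < kap /\ kap < k * s / (1 + `|L|)]).
    split => /=; first by apply: nbhsx_ballx; rewrite divr_gt0.
    near=> kap; split; first by near: kap; exact: nbhs_right_gt.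
    by near: kap; apply: nbhs_right_lt; rewrite !(divr_gt0, mulr_gt0).
  move=> [m kap] [/= Bm [kap0 kapL]] Mm n y Kn Ky.
  have [->|n0] := eqVneq n 0; first by rewrite normr0 mulr0 mul0r inner0r.
  have [b b0 ->] := normal_cone Mm Kn n0.
  have Bm' : ball x r m by apply: le_ball Bm; lra.
  have [Km _] := (boundaryP m).1 Mm.
  have my : `|m - y| <= 2 * rho.
    by apply: le_trans (ler_normB _ _) _; have := Krho _ Km; have := Krho _ Ky; lra.
  pose z := m + s *: (y - m).
  have s1 : s < 1 by rewrite ltr_pdivrMr//; lra.
  have smy : `|s *: (y - m)| < r / 2.
    rewrite normrZ (gtr0_norm s0) distrC mulrAC ltr_pdivrMr//.
    by rewrite ltr_pM2l ?divr_gt0//; lra.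
  have Bz : ball x r z.
    move: Bm; rewrite -!ball_normE /= => xm.
    rewrite /z opprD addrA; apply: le_lt_trans (ler_normB _ _) _; lra.
  have Kz : K z by apply: body_segment => //; rewrite !ltW.
  have := chart_strong_normal k0 BU Fc Mm Bm' Bz Kz.
  have -> : m - z = s *: (m - y) by apply/rowP => i; rewrite !mxE; ring.
  rewrite innerZl normrZ (gtr0_norm s0) exprMn => main0.
  have main : s * (k * `|m - y| ^+ 2) <= inner (m - y) (grad F m).
    rewrite -(ler_pM2l s0); apply: le_trans main0.
    by rewrite le_eqVlt; apply/orP; left; apply/eqP; ring.
  rewrite innerZr normrZ (gtr0_norm b0).
  have gm := le_trans (gL _ Bm') (ler_norm L).
  have sq : 0 <= `|m - y| ^+ 2 by rewrite exprn_ge0.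
  apply: le_trans (_ : b * (s * (k * `|m - y| ^+ 2)) <= _); last first.
    by rewrite ler_pM2l.
  have : kap * `|grad F m| <= k * s.
    apply: le_trans (_ : kap * (1 + `|L|) <= _); last by rewrite -ler_pdivlMr// ltW.
    by rewrite ler_pM2l//; lra.
  move=> /(ler_wpM2r sq)/(ler_wpM2l (ltW b0)).
  by congr (_ <= _); ring.
move=> H; have : \forall kap \near (0 : R)^'+, 0 < kap /\ boundary K `<=` P kap.
  by near=> kap; split; near: kap => //; exact: nbhs_right_gt.
move=> /filter_ex[kap [kap0 Hkap]]; exists kap => // m n y Mm Kn Ky.
exact: Hkap.
Unshelve. all: by end_near. Qed.

(** * The difference body and its Reeb vectors *)

Lemma diff_body_closed : closed (diff_body K).
Proof.
have -> : diff_body K = [set p.1 - p.2 | p in K `*` K].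
  apply/seteqP; split => y /=.
    by move=> [a Ka [b Kb <-]]; exists (a, b).
  by move=> [[a b] [Ka Kb] <-]; exists a => //; exists b.
have cptK := bounded_closed_compact bK cK.
apply: compact_closed; first exact: norm_hausdorff.
apply: continuous_compact (compact_setX cptK cptK).
by apply: continuous_subspaceT => p; apply: cvgB; [exact: cvg_fst | exact: cvg_snd].
Qed.

Lemma diff_body_scale y (r : R) : diff_body K y -> 0 <= r < 1 ->
  interior (diff_body K) (r *: y).
Proof.
move=> [a Ka [b Kb <-]] r01.
have [rho rho0 Krho] := interior_ball (interior_scale Ka r01).
apply/nbhs_ballP; exists rho => //= z; rewrite -ball_normE/= => zr.
exists (z + r *: b); last by exists (r *: b); rewrite ?addrK//;
  apply: interior_subset; exact: interior_scale.
have -> : z + r *: b = r *: a + (z - r *: (a - b)).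
  by apply/rowP => i; rewrite !mxE; ring.
by apply: Krho; rewrite distrC.
Qed.

Lemma diff_body_normal a b n : is_normal K a n -> is_normal K b (- n) ->
  is_normal (diff_body K) (a - b) n.
Proof.
move=> an bn _ [a' Ka' [b' Kb' <-]]; have := an _ Ka'; have := bn _ Kb'.
by rewrite !innerE; lra.
Qed.

(** No defining function of the symmetrization is at hand. Its tangent vectors at [a - b] are
    obtained by moving [a] inside [K] with [contact] while [b] stays fixed. *)
Lemma reeb_symmetrization a b n : K a -> K b -> is_normal K a n ->
  is_normal K b (- n) -> n != 0 ->
  reeb (symmetrization K) (a - b) = (inner (a - b) n)^-1 *: Jc n.
Proof.
move=> Ka Kb an bn n0; have dn := diff_body_normal an bn.
have Dab : diff_body K (a - b) by exists a => //; exists b.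
have cD := diff_body_closed.
have D0 : interior (diff_body K) 0.
  by rewrite -(scale0r (a - b)); apply: diff_body_scale; rewrite ?lexx ?ltr01.
have qn := normal_inner_gt0 D0 dn n0.
apply: reeb_normal => // v; split => [|vn].
  by apply: tangent_normal dn => y /(boundary_closed _ cD)[].
have Ma := normal_boundary cK Ka n0 an.
have [l l0 nE] := normal_cone Ma an n0.
have gv : inner (grad F a) v = 0.
  by move/eqP: vn; rewrite nE innerZr mulf_eq0 gt_eqF//= innerC => /eqP.
have gq : 0 < inner (grad F a) (a - b).
  by move: qn; rewrite nE innerZr pmulr_rgt0// innerC.
apply: (tangent_radial cD diff_body_scale Dab dn) => // e e0.
have := contact Ma gv gq e0; apply: filterS => t Kt.
exists (a + t *: v - (e * `|t|) *: (a - b + t *: v)) => //; exists b => //.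
by apply/rowP => i; rewrite !mxE; ring.
Qed.

Lemma support_point u : exists a, K a /\ is_normal K a u.
Proof.
have cptK := bounded_closed_compact bK cK.
have Kn0 : K !=set0 by exists 0; exact: interior_subset.
have [|a Ka aP] := compact_EVT_max (f := fun y : vec R d => inner y u) Kn0 cptK.
  by apply: continuous_subspaceT; exact: inner_continuous.
exists a; split; first by rewrite inE in Ka.
by move=> y Ky; apply: aP; rewrite inE.
Qed.

(** * The polar norm as a width function *)

Section Billiard.
Variable H : vec R d -> R.
Hypothesis H_homog : forall (t : R) x, 0 < t -> H (t *: x) = t * H x.
Hypothesis H_polar : sympl_polar (symmetrization K) = [set x | H x = 1].

(** The point [b - a] of the symmetrization has outer normal [- Jc x], which [Jc] sends to [x]. Its
    Reeb vector is therefore [x] divided by the width, and [H] equals 1 there. *)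
Lemma H_width x a b : K a -> K b -> is_normal K a (Jc x) -> is_normal K b (- Jc x) ->
  H x = inner (a - b) (Jc x).
Proof.
move=> Ka Kb ax bx; have [->|x0] := eqVneq x 0.
  have Jc0 : Jc (0 : vec R d) = 0 by rewrite -(scale0r 0) JcZ !scale0r.
  (* Homogeneity with factor 2 gives [H 0 = 2 * H 0], hence [H 0 = 0]. *)
  by have := @H_homog 2 0 (ltr0Sn _ 1); rewrite scaler0 Jc0 inner0r; lra.
have Jx0 : - Jc x != 0 by rewrite oppr_eq0 -normr_eq0 normv_Jc normr_eq0.
have ax' : is_normal K a (- - Jc x) by rewrite opprK.
have := reeb_symmetrization Kb Ka bx ax' Jx0; rewrite JcN JcK opprK.
have -> : inner (b - a) (- Jc x) = inner (a - b) (Jc x) by rewrite !innerE; ring.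
set w := inner _ _ => rE.
have w0 : 0 < w.
  have Jx : Jc x != 0 by rewrite -oppr_eq0.
  have Ma := normal_inner_gt0 K0 ax Jx; have := normal_inner_gt0 K0 bx Jx0.
  by rewrite /w innerNr innerDl innerNl; lra.
have : [set z | H z = 1] (w^-1 *: x).
  rewrite -H_polar -rE; exists (b - a) => //.
  apply: (normal_boundary (n := - Jc x) diff_body_closed) => //.
    by exists b => //; exists a.
  exact: diff_body_normal.
rewrite /= H_homog ?invr_gt0// => /(congr1 (fun r => w * r)).
by rewrite mulVKf ?gt_eqF// mulr1.
Qed.

Lemma H_bounds (rho : R) x : (forall y, K y -> `|y| <= rho) ->
  0 <= H x <= (d + d)%:R * (2 * rho) * `|x|.
Proof.
move=> Krho; have [a [Ka ax]] := support_point (Jc x).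
have [b [Kb bx]] := support_point (- Jc x).
have K00 := interior_subset K0; rewrite (H_width Ka Kb ax bx); apply/andP; split.
  by have := ax _ K00; have := bx _ K00; rewrite !innerE; lra.
apply: le_trans (ler_norm _) _; apply: le_trans (inner_le_normv _ _) _.
rewrite normv_Jc ler_wpM2r// ler_wpM2l//.
by apply: le_trans (ler_normB _ _) _; have := Krho _ Ka; have := Krho _ Kb; lra.
Qed.

(** * Two steps of the billiard map *)

Section Step.
Variables rho kap : R.
Hypotheses (rho0 : 0 < rho) (kap0 : 0 < kap).
Hypothesis Krho : forall y, K y -> `|y| <= rho.
Hypothesis Kkap : forall m n y, boundary K m -> is_normal K m n -> K y ->
  kap * `|n| * `|m - y| ^+ 2 <= inner (m - y) n.

(** The added 1 keeps the constant positive even when [d] is 0. *)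
Let C : R := (d + d)%:R + 1.

Let C0 : 0 < C. Proof. by rewrite ltr_wpDl. Qed.

Let Ckap : 0 < 2 * C / kap. Proof. by rewrite divr_gt0// mulr_gt0. Qed.

Let inner_le u v : `|inner u v| <= C * `|u| * `|v|.
Proof.
apply: le_trans (inner_le_normv _ _) _.
by rewrite ler_wpM2r// ler_wpM2r// lerDl.
Qed.

(** Maximality of [b] gives [inner (a - b) u <= inner (b - a) e]. The left side is at least
    quadratic in [a - b] and the right side at most linear, so one factor cancels. *)
Lemma support_stable u e a b : K a -> K b -> is_normal K a u ->
  is_normal K b (u + e) -> `|a - b| * (kap * `|u|) <= C * `|e|.
Proof.
move=> Ka Kb au bu; have Ce : 0 <= C * `|e| by rewrite mulr_ge0// ltW.
have [->|u0] := eqVneq u 0; first by rewrite normr0 !mulr0.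
have [->|ab] := eqVneq a b; first by rewrite subrr normr0 mul0r.
have nab : 0 < `|a - b| by rewrite normr_gt0 subr_eq0.
have := Kkap (normal_boundary cK Ka u0 au) au Kb.
have := bu _ Ka; have := inner_le (b - a) e; rewrite distrC.
have := ler_norm (inner (b - a) e); rewrite !innerE => h1 h2 h3 h4.
rewrite -(ler_pM2l nab).
have -> : `|a - b| * (`|a - b| * (kap * `|u|)) = kap * `|u| * `|a - b| ^+ 2 by ring.
have -> : `|a - b| * (C * `|e|) = C * `|a - b| * `|e| by ring.
by lra.
Qed.

(** Such an [m] is a fixed point of the map sending [m] to a maximiser in direction [Jc (x - m)]. As
    [m] has norm at most [rho], the threshold keeps [x - m] at least [2 * C / kap] long, and
    [support_stable] makes the map a contraction of ratio one half. *)
Lemma tangency_point_exists x : rho + 2 * C / kap <= `|x| ->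
  exists m, K m /\ is_normal K m (Jc (x - m)).
Proof.
move=> xbig.
have [q qP] := choice support_point.
pose f m := q (Jc (x - m)).
have fK : {homo f : m / K m >-> K m} by move=> m _; exact: (qP _).1.
have ctr : is_contraction (mkfun fK : {fun K >-> K}).
  exists (2^-1)%:nng; split => /=; first by lra.
  move=> [m m'] /= [Km Km']; rewrite /self_sub /=.
  have := support_stable (u := Jc (x - m)) (e := Jc (m - m')) (fK m Km) (fK m' Km')
    (qP _).2.
  have -> : Jc (x - m) + Jc (m - m') = Jc (x - m') by rewrite -JcD addrA subrK.
  move=> /(_ (qP _).2); rewrite !normv_Jc => h.
  have xm : 2 * C <= kap * `|x - m|.
    rewrite [leRHS]mulrC -ler_pdivrMr//; have := lerB_dist x m; have := Krho Km.
    by lra.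
  rewrite -(ler_pM2l C0) -/(f m) -/(f m').
  have h2 := ler_wpM2l (normr_ge0 (f m - f m')) xm.
  by move: h h2; rewrite -/(f m) -/(f m'); lra.
have [|m Km fm] := banach_fixed_point ctr cK.
  by exists 0; exact: interior_subset.
by exists m; split => //; rewrite {1}fm; exact: (qP _).2.
Qed.

Lemma normalZ m n (t : R) : 0 <= t -> is_normal K m n -> is_normal K m (t *: n).
Proof. by move=> t0 mn y /mn yn; rewrite !innerZr ler_wpM2l. Qed.

(** When no tangency point exists, [xget] returns its default 0, which also lies in [K]; the
    conclusion thus covers every [x]. *)
Lemma m_minus_body x : K (m_minus (boundary K) x).
Proof.
rewrite /m_minus; case: xgetP => [m _ [/boundaryP[]]//|_].
exact: interior_subset.
Qed.

Lemma m_minus_normal x : rho + 2 * C / kap <= `|x| ->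
  is_normal K (m_minus (boundary K) x) (Jc (x - m_minus (boundary K) x)).
Proof.
move=> xbig; set m := m_minus _ _.
(* The fixed point of [tangency_point_exists] shows that the defining set is nonempty, so [m] is a
   true tangency point and not the default value. *)
have [Mm [l l0 mE]] : boundary K m /\
    exists2 l : R, 0 < l & m - x = l *: reeb (boundary K) m.
  apply: (@xgetPex _ 0 [set m : vec R d | boundary K m /\
    exists2 l : R, 0 < l & m - x = l *: reeb (boundary K) m]).
  have [p [Kp pn]] := tangency_point_exists xbig.
  have xp : x - p != 0.
    rewrite -normr_gt0; apply: lt_le_trans (lerB_dist x p).
    by have := Krho Kp; have := Ckap; move: xbig; lra.
  have n0 : Jc (x - p) != 0 by rewrite -normr_eq0 normv_Jc normr_eq0.
  have Mp := normal_boundary cK Kp n0 pn; have pp := normal_inner_gt0 K0 pn n0.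
  exists p; split => //; exists (inner p (Jc (x - p))) => //.
  rewrite (reeb_boundary Mp pn n0) scalerA mulfV ?gt_eqF// scale1r JcK.
  by rewrite opprB.
have gm := grad_inner_gt0 Mm.
have g0 : grad F m != 0 by apply: contraTneq gm => ->; rewrite inner0l ltxx.
have -> : x - m = - (m - x) by rewrite opprB.
rewrite mE (reeb_boundary Mm (grad_normal Mm) g0) scalerA JcN JcZ JcK scalerN opprK.
apply: normalZ (grad_normal Mm).
by rewrite mulr_ge0 ?invr_ge0 ?ltW// innerC.
Qed.

(* [inner (m1 - m2) (Jc (m2 - m1)) = 0], so only the distance from [(m1, m2)] to
   the support points [(a, b)] in direction [Jc y] contributes. *)
Lemma drift_bound y a b m1 m2 e1 e2 : K a -> K b -> K m1 -> K m2 ->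
  is_normal K a (Jc y) -> is_normal K b (- Jc y) ->
  is_normal K m1 (Jc y + e1) -> is_normal K m2 (- Jc y + e2) ->
  `|e1| <= 3 * rho -> `|e2| <= 3 * rho ->
  `|inner (a - b) (Jc (2 *: (m2 - m1)))| * (kap * `|y|) <= 24 * C ^+ 2 * rho ^+ 2.
Proof.
move=> Ka Kb Km1 Km2 ay by' m1y m2y e1r e2r.
have -> : inner (a - b) (Jc (2 *: (m2 - m1))) =
    2 * inner ((a - m1) - (b - m2)) (Jc (m2 - m1)).
  have -> : a - m1 - (b - m2) = (a - b) + (m2 - m1).
    by apply/rowP => i; rewrite !mxE; ring.
  by rewrite [inner (_ + (m2 - m1)) _]innerDl inner_Jc_id addr0 JcZ innerZr.
have h1 := support_stable Ka Km1 ay m1y; have h2 := support_stable Kb Km2 by' m2y.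
rewrite normrN normv_Jc in h2; rewrite normv_Jc in h1.
have m21 : `|m2 - m1| <= 2 * rho.
  by apply: le_trans (ler_normB _ _) _; have := Krho Km1; have := Krho Km2; lra.
have sumab : `|a - m1 - (b - m2)| <= `|a - m1| + `|b - m2| by exact: ler_normB.
have Ce1 : C * `|e1| <= C * (3 * rho) by rewrite ler_pM2l.
have Ce2 : C * `|e2| <= C * (3 * rho) by rewrite ler_pM2l.
have ky : 0 <= kap * `|y| by rewrite mulr_ge0// ltW.
have := inner_le (a - m1 - (b - m2)) (Jc (m2 - m1)); rewrite normv_Jc => hin.
rewrite normrM ger0_norm//.
have hin2 : `|inner (a - m1 - (b - m2)) (Jc (m2 - m1))| <=
    C * (`|a - m1| + `|b - m2|) * (2 * rho).
  apply: le_trans hin _; apply: ler_pM => //; first by rewrite mulr_ge0// ltW.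
  by rewrite ler_pM2l.
have hs : (`|a - m1| + `|b - m2|) * (kap * `|y|) <= 2 * (C * (3 * rho)) by lra.
have Crho : 0 <= 4 * C * rho by rewrite !mulr_ge0// ltW.
have := ler_wpM2l Crho hs; have := ler_wpM2r ky hin2; lra.
Qed.

Let T := outer_billiard (boundary K).

Lemma billiard_sqr x :
  T (T x) = x + 2 *: (m_minus (boundary K) (T x) - m_minus (boundary K) x).
Proof.
rewrite {1}/T /outer_billiard -/(T x) {2}/T /outer_billiard.
by apply/rowP => i; rewrite !mxE; ring.
Qed.

Lemma billiard_sqr_dist x : `|T (T x) - x| <= 4 * rho.
Proof.
rewrite billiard_sqr addrC addKr normrZ ger0_norm//.
have := ler_normB (m_minus (boundary K) (T x)) (m_minus (boundary K) x).
have := Krho (m_minus_body x); have := Krho (m_minus_body (T x)); lra.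
Qed.

(** Beyond this radius both [x] and [T x] pass the threshold of [m_minus_normal], and two steps,
    which move [x] by at most [4 * rho], cannot halve its norm. *)
Let far : R := 2 * (rho + 2 * C / kap) + 8 * rho.

Lemma H_drift x : far <= `|x| ->
  `|H (T (T x)) - H x| * (kap * `|x|) <= 48 * C ^+ 2 * rho ^+ 2.
Proof.
move=> xbig; have r0 := rho0; have Ck := Ckap.
set m1 := m_minus (boundary K) x; set m2 := m_minus (boundary K) (T x).
have Km1 : K m1 := m_minus_body x; have Km2 : K m2 := m_minus_body (T x).
have m1n : is_normal K m1 (Jc (x - m1)).
  by apply: m_minus_normal; move: xbig; rewrite /far; lra.
have TxE : T x = 2 *: m1 - x by [].
have m2n : is_normal K m2 (Jc (T x - m2)).
  apply: m_minus_normal; rewrite TxE.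
  have := lerB_dist x (2 *: m1); rewrite (distrC x) normrZ ger0_norm//.
  by have := Krho Km1; move: xbig; rewrite /far; lra.
have x'E : T (T x) = x + 2 *: (m2 - m1) := billiard_sqr x.
set x' := T (T x) in x'E *.
have x'x : `|x| <= 2 * `|x'|.
  have := lerB_dist x (x - x'); rewrite subKr (distrC x).
  by have := billiard_sqr_dist x; rewrite -/x'; move: xbig; rewrite /far; lra.
have [a [Ka ax]] := support_point (Jc x).
have [b [Kb bx]] := support_point (- Jc x).
have [a' [Ka' ax']] := support_point (Jc x').
have [b' [Kb' bx']] := support_point (- Jc x').
have r1 := Krho Km1; have r2 := Krho Km2.
(* The tangency directions [Jc (x - m1)] and [Jc (T x - m2)] differ from [Jc x] and [- Jc x] by at
   most [3 * rho]. Below, the same directions are compared with those of [x']. *)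
have D : `|inner (a - b) (Jc (2 *: (m2 - m1)))| * (kap * `|x|) <=
    24 * C ^+ 2 * rho ^+ 2.
  apply: (drift_bound (e1 := - Jc m1) (e2 := Jc (2 *: m1 - m2)) Ka Kb) => //.
  - by rewrite -JcN -JcD.
  - suff -> : - Jc x + Jc (2 *: m1 - m2) = Jc (T x - m2) by [].
    by rewrite -JcN -JcD TxE; congr Jc; apply/rowP => i; rewrite !mxE; ring.
  - by rewrite normrN normv_Jc; lra.
  - rewrite normv_Jc; apply: le_trans (ler_normB _ _) _.
    by rewrite normrZ ger0_norm//; lra.
have D' : `|inner (a' - b') (Jc (2 *: (m2 - m1)))| * (kap * `|x'|) <=
    24 * C ^+ 2 * rho ^+ 2.
  apply: (drift_bound (e1 := Jc (m1 - 2 *: m2)) (e2 := Jc m2) Ka' Kb') => //.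
  - suff -> : Jc x' + Jc (m1 - 2 *: m2) = Jc (x - m1) by [].
    by rewrite -JcD x'E; congr Jc; apply/rowP => i; rewrite !mxE; ring.
  - suff -> : - Jc x' + Jc m2 = Jc (T x - m2) by [].
    by rewrite -JcN -JcD TxE x'E; congr Jc; apply/rowP => i; rewrite !mxE; ring.
  - rewrite normv_Jc; apply: le_trans (ler_normB _ _) _.
    by rewrite normrZ ger0_norm//; lra.
  - by rewrite normv_Jc; lra.
have HxE := H_width Ka Kb ax bx; have HxE' := H_width Ka' Kb' ax' bx'.
(* As a maximum, [H x'] is at least the value of the pair optimal for [x]; the upper bound exchanges
   the roles of [x] and [x']. *)
have lo : inner (a - b) (Jc (2 *: (m2 - m1))) <= H x' - H x.
  have := ax' _ Ka; have := bx' _ Kb; rewrite HxE HxE' x'E !(JcE, innerE).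
  by lra.
have hi : H x' - H x <= inner (a' - b') (Jc (2 *: (m2 - m1))).
  have := ax _ Ka'; have := bx _ Kb'; rewrite HxE HxE' x'E !(JcE, innerE).
  by lra.
have kx : 0 <= kap * `|x| by rewrite mulr_ge0// ltW.
have kx' : kap * `|x| <= 2 * (kap * `|x'|) by rewrite mulrCA ler_pM2l.
set P := inner (a - b) _ in D lo; set P' := inner (a' - b') _ in D' hi.
have [H0|H0] := leP 0 (H x' - H x).
  rewrite ger0_norm//; have P'n : H x' - H x <= `|P'| by apply: le_trans (ler_norm _).
  have := ler_pM H0 kx P'n kx'; lra.
rewrite ltr0_norm//; have Pn : - (H x' - H x) <= `|P|.
  by have := ler_norm (- P); rewrite normrN; lra.
have := ler_wpM2r kx Pn; have : 0 <= 24 * C ^+ 2 * rho ^+ 2.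
  by rewrite !mulr_ge0// ltW.
by lra.
Qed.

(** Far away, the difference of squares is [H_drift] times a sum of order [|x|], so the norm cancels
    and leaves [E]. Otherwise both points lie in a ball where [H] is at most [B]. *)
Lemma H_sqr_step : exists2 Cb : R, 0 < Cb &
  forall x, `|H (T (T x)) ^+ 2 - H x ^+ 2| <= Cb.
Proof.
have r0 := rho0; have Ck := Ckap; pose A := C * (2 * rho).
have A0 : 0 < A by rewrite !mulr_gt0.
have HA x : 0 <= H x <= A * `|x|.
  have /andP[-> h] := H_bounds x Krho; apply: le_trans h _.
  by rewrite ler_wpM2r// ler_wpM2r ?lerDl// mulr_ge0// ltW.
pose B := A * (far + 4 * rho).
have far0 : 0 < far by rewrite /far; lra.
have B0 : 0 < B by rewrite mulr_gt0// addr_gt0// mulr_gt0.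
pose E := 3 * A * (48 * C ^+ 2 * rho ^+ 2) / kap.
have E0 : 0 < E by rewrite !(divr_gt0, mulr_gt0, exprn_gt0).
exists (B ^+ 2 + E) => [|x]; first by rewrite addr_gt0// exprn_gt0.
have /andP[H0 Hx] := HA x; have /andP[H0' Hx'] := HA (T (T x)).
have x'x : `|T (T x)| <= `|x| + 4 * rho.
  have := ler_normD (T (T x) - x) x; rewrite subrK; have := billiard_sqr_dist x; lra.
have [xfar|xnear] := leP far `|x|.
  have h := H_drift xfar.
  have x4 : 4 * rho <= `|x| by move: xfar; rewrite /far; lra.
  (* The factor 3 is 1 for [x] plus 2 for [T (T x)], whose norm is at most twice that of [x]. *)
  have s : H (T (T x)) + H x <= 3 * A * `|x|.
    have : A * `|T (T x)| <= A * (`|x| + `|x|) by rewrite ler_pM2l//; lra.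
    by lra.
  rewrite subr_sqr normrM [`|H (T (T x)) + H x|]ger0_norm ?addr_ge0//.
  apply: le_trans (_ : E <= _); last by rewrite lerDr exprn_ge0// ltW.
  rewrite ler_pdivlMr//.
  have A3 : 0 <= 3 * A by rewrite mulr_ge0// ltW.
  have := ler_wpM2l A3 h.
  have := ler_wpM2l (mulr_ge0 (normr_ge0 (H (T (T x)) - H x)) (ltW kap0)) s.
  by lra.
have bd z : `|z| <= far + 4 * rho -> 0 <= H z ^+ 2 <= B ^+ 2.
  move=> zf; rewrite exprn_ge0/=; last by have /andP[] := HA z.
  have /andP[Hz Hz'] := HA z; rewrite ler_sqr ?nnegrE// ?(ltW B0)//.
  by apply: le_trans Hz' _; rewrite ler_pM2l.
have /andP[a1 a2] : 0 <= H x ^+ 2 <= B ^+ 2 by apply: bd; lra.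
have /andP[b1 b2] : 0 <= H (T (T x)) ^+ 2 <= B ^+ 2 by apply: bd; lra.
by rewrite ler_norml; apply/andP; split; lra.
Qed.

End Step.

Lemma H_sqr_iter : exists2 Cb : R, 0 < Cb & forall x k,
  `|H (iter (2 * k) (outer_billiard (boundary K)) x) ^+ 2 - H x ^+ 2| <= Cb * k%:R.
Proof.
have [rho rho0 Krho] := body_bounded; have [kap kap0 Kkap] := uniformly_convex.
have [Cb Cb0 step] := H_sqr_step rho0 kap0 Krho Kkap.
exists Cb => // x; elim=> [|k IHk]; first by rewrite subrr normr0 mulr0.
rewrite mulnS iterD /=; set y := iter _ _ _ in IHk *.
rewrite -(subrK (H y ^+ 2) (H _ ^+ 2)) -addrA; apply: le_trans (ler_normD _ _) _.
by have := step y; rewrite -natr1 mulrDr mulr1; lra.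
Qed.

End Billiard.

End ConvexBody.

Theorem theorem3p5 (R : realType) (d : nat)
    (M K : set (vec R d)) (U : set (vec R d)) (F : vec R d -> R) (c : R)
    (H : vec R d -> R) :
  (* K is the (closed) domain bounded by M *)
  closed K -> bounded_set K -> convex_set K ->
  (* strict convexity *)
  (forall a b : vec R d, K a -> K b -> a != b -> forall t : R, 0 < t -> t < 1 ->
      interior K (t *: a + (1 - t) *: b)) ->
  interior K 0 ->
  M = boundary K ->
  (* M is a level set of a smooth function with positive definite Hessian *)
  open U -> M `<=` U -> smooth_on U F -> (forall x, U x -> hessian_posdef F x) ->
  M = [set q | U q /\ F q = c] ->
  (* H is the positively 1-homogeneous function with N = {H = 1},
     N the symplectic polar of the symmetrization of M *)
  (forall (t : R) (x : vec R d), 0 < t -> H (t *: x) = t * H x) ->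
  sympl_polar (symmetrization K) = [set x | H x = 1] ->
  exists2 Lam : R, 0 < Lam & exists2 Cb : R, 0 < Cb &
    forall x : vec R d, Lam <= H x -> forall k : nat, (1 <= k)%N ->
      `| H (iter (2 * k) (outer_billiard M) x) ^+ 2 - H x ^+ 2 | <= Cb * k%:R.
Proof.
move=> cK bK _ strictK K0 -> oU MU sF pF ME H_homog H_polar.
have [Cb Cb0 HCb] := H_sqr_iter cK bK strictK K0 oU MU sF pF ME H_homog H_polar.
(* The constant of [H_sqr_iter] is uniform over all starting points, so any positive number can
   serve as threshold; 1 is chosen. *)
by exists 1 => //; exists Cb => // x _ k _; exact: HCb.
Qed.
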